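(* Let $W$ be an $N\times N$ matrix with positive entries, let $b\in\mathbb{R}^N$ be a vector all of whose entries are larger than $-2$, and let $\sigma(t)=\frac{1}{1+e^{-t}}$ be the sigmoid function, applied componentwise to vectors. Then the layer map $T(x)=\sigma(Wx+b)$ is non-expansive with respect to the Thompson metric $d$ on the standard positive cone $X=\{x\in\mathbb{R}^N: x(i)>0\text{ for all }i\}$, i.e. $d(Tx,Ty)\le d(x,y)$ for all $x,y\in X$.
   Context: The Thompson metric on $X$ is $$d(x,w)=\log\Big(\max\Big\{\max_i\tfrac{x(i)}{w(i)},\ \max_i\tfrac{w(i)}{x(i)}\Big\}\Big),$$ where $x(i)$ denotes the $i$-th coordinate of $x$. *)

(* Defs.v *)
From mathcomp Require Import all_boot all_order all_algebra.
From mathcomp Require Import all_classical all_reals all_analysis.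

Set Implicit Arguments.
Unset Strict Implicit.
Unset Printing Implicit Defensive.

Import Order.TTheory GRing.Theory Num.Theory.

Local Open Scope classical_set_scope.
Local Open Scope ring_scope.

Definition positive_cone (R : realType) (N : nat) : set 'cV[R]_N :=
  [set x | forall i, 0 < x i ord0].

(* The maxima are folded from 0; on the positive cone all ratios are positive,
   so for N > 0 this is the maximum of the ratios. For N = 0 the cone has a
   single point, and its distance to itself is ln 0 = 0. *)
Definition max_ratio (R : realType) (N : nat) (x w : 'cV[R]_N) : R :=
  \big[Num.max/0]_(i < N) (x i ord0 / w i ord0).

Definition thompson (R : realType) (N : nat) (x w : 'cV[R]_N) : R :=
  ln (Num.max (max_ratio x w) (max_ratio w x)).

Definition sigmoid (R : realType) (t : R) : R := 1 / (1 + expR (- t)).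

Definition layer (R : realType) (N : nat) (W : 'M[R]_N) (b x : 'cV[R]_N) :
  'cV[R]_N := map_mx (@sigmoid R) (W *m x + b).

Definition nonexpansive_on (R : realType) (V : Type) (d : V -> V -> R)
    (X : set V) (T : V -> V) : Prop :=
  forall x y, X x -> X y -> d (T x) (T y) <= d x y.

Lemma layer_positive_cone (R : realType) (N : nat) (W : 'M[R]_N)
    (b x : 'cV[R]_N) : positive_cone (layer W b x).
Proof.
by move=> i; rewrite mxE /sigmoid divr_gt0// addr_gt0// expR_gt0.
Qed.

(* Main.v *)
Require Import Defs.
From mathcomp Require Import all_boot all_order all_algebra.
From mathcomp Require Import all_classical all_reals all_analysis.
From mathcomp Require Import ring lra.

Import Order.TTheory GRing.Theory Num.Theory.
Import numFieldNormedType.Exports.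
Local Open Scope ring_scope.

(** Non-expansiveness amounts to [sigma (l * s + b) <= l * sigma (s + b)] for
    [l >= 1], i.e. to the monotonicity of [s / sigma (s + b)
    = s * (1 + exp (- (s + b)))]. The derivative
    [1 + exp (- (s + b)) * (1 - s)] is nonnegative because
    [exp (s + b) >= 1 + s + b > s - 1]: this is where [b > -2] is used. *)

Lemma sigmoid_gt0 (R : realType) (t : R) : 0 < sigmoid t.
Proof. by rewrite divr_gt0// addr_gt0// expR_gt0. Qed.

Lemma sigmoid_le (R : realType) : {homo @sigmoid R : s t / s <= t}.
Proof.
move=> s t st; rewrite /sigmoid !div1r lef_pV2 ?posrE ?addr_gt0 ?expR_gt0//.
by rewrite lerD2l ler_expR lerN2.
Qed.

Lemma div_sigmoid_le (R : realType) (b : R) : -2 < b ->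
  {homo (fun s : R => s / sigmoid (s + b)) : s t / s <= t}.
Proof.
move=> b_gt s t st.
pose f (x : R) := x * (1 + expR (- (x + b))).
pose df (x : R) := 1 + expR (- (x + b)) * (1 - x).
have fE x : x / sigmoid (x + b) = f x by rewrite /sigmoid div1r invrK.
have f_drv x : is_derive x (1 : R) f (df x).
  have exp_drv : is_derive x (1 : R) (fun z => expR (- (z + b)))
      (expR (- (x + b)) * (- (1 + 0))).
    exact: (is_derive1_comp (f := expR) (g := fun z => - (z + b))).
  by apply: is_derive_eq; rewrite /df /GRing.scale/=; ring.
have df_ge0 x : 0 <= df x.
  have := expR_ge1Dx (x + b).
  rewrite /df expRN; have := expR_gt0 (x + b).
  set e := expR _ => e_gt0 le_e.
  (* Multiplied by [e], [df x] becomes [e + 1 - x], which [le_e] bounds below by [2 + b > 0]. *)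
  rewrite -(pmulr_rge0 _ e_gt0) mulrDr mulrA divff ?gt_eqF//; lra.
rewrite !fE.
have f_cont : ({within `[s, t], continuous f})%classic.
  apply: continuous_subspaceT => x.
  exact/differentiable_continuous/derivable1_diffP.
have [c _ fst] := MVT_segment (df := df) st (fun x _ => f_drv x) f_cont.
by rewrite -subr_ge0 fst mulr_ge0// subr_ge0.
Qed.

Lemma sigmoid_scale_le (R : realType) (b l s : R) :
  -2 < b -> 1 <= l -> 0 < s -> sigmoid (l * s + b) <= l * sigmoid (s + b).
Proof.
move=> b_gt l_ge1 s_gt0.
(* Monotonicity between [s] and [l * s]; clearing denominators and cancelling [s] leaves the
   claim. *)
have := @div_sigmoid_le R b b_gt s (l * s) (ler_peMl (ltW s_gt0) l_ge1).
rewrite ler_pdivrMr ?sigmoid_gt0// mulrAC ler_pdivlMr ?sigmoid_gt0//.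
by rewrite -mulrA mulrCA ler_pM2l// mulrA.
Qed.

Lemma le_max_ratio (R : realType) (N : nat) (x y : 'cV[R]_N) (i : 'I_N) :
  x i ord0 / y i ord0 <= max_ratio x y.
Proof. exact: (le_bigmax _ (fun j => x j ord0 / y j ord0)). Qed.

(** One of [x i / y i] and its inverse is at least 1. The index [i] forces [N > 0]: in dimension 0
    both folds are 0. *)
Lemma max_max_ratio_ge1 (R : realType) (N : nat) (x y : 'cV[R]_N) (i : 'I_N) :
  positive_cone x -> positive_cone y ->
  1 <= Num.max (max_ratio x y) (max_ratio y x).
Proof.
move=> x_gt0 y_gt0; rewrite le_max; apply/orP.
case: (leP (y i ord0) (x i ord0)) => [yx|/ltW xy]; [left|right].
- by apply: le_trans (le_max_ratio R _ x y i); rewrite ler_pdivlMr// mul1r.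
- by apply: le_trans (le_max_ratio R _ y x i); rewrite ler_pdivlMr// mul1r.
Qed.

(** The bound on ratios says [x <= l * y] entrywise; the positive matrix [W] preserves this, and the
    sigmoid, being increasing, lets [l] be pulled out by [sigmoid_scale_le]. *)
Lemma max_ratio_layer_le (R : realType) (N : nat) (W : 'M[R]_N)
    (b x y : 'cV[R]_N) (l : R) :
  (forall i j, 0 < W i j) -> (forall i, -2 < b i ord0) ->
  positive_cone y -> 1 <= l -> max_ratio x y <= l ->
  max_ratio (layer W b x) (layer W b y) <= l.
Proof.
move=> W_gt0 b_gt y_gt0 l_ge1 xy_le.
(* As the fold starts from 0, [0 <= l] is also required. *)
apply: bigmax_le => [|i _]; first exact: le_trans l_ge1.
rewrite ler_pdivrMr; last exact: layer_positive_cone.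
have Wy_gt0 : 0 < (W *m y) i ord0.
  (* The diagonal term alone is positive, the others only add to it. *)
  rewrite mxE (bigD1 i)//= ltr_wpDr ?mulr_gt0//.
  by apply: sumr_ge0 => j _; rewrite ltW ?mulr_gt0.
rewrite [leLHS]mxE [in leRHS]mxE [(_ + b) _ _]mxE [(_ + b) _ _ in leRHS]mxE.
apply: le_trans (sigmoid_scale_le _ _ _ _ (b_gt i) l_ge1 Wy_gt0).
apply: sigmoid_le; rewrite lerD2r !mxE mulr_sumr; apply: ler_sum => j _.
rewrite mulrCA ler_pM2l// -ler_pdivrMr//.
exact: le_trans (le_max_ratio R _ x y j) xy_le.
Qed.

Theorem proposition3 (R : realType) (N : nat) (W : 'M[R]_N) (b : 'cV[R]_N)
    (W_gt0 : forall i j : 'I_N, 0 < W i j)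
    (b_gtN2 : forall i : 'I_N, -2 < b i ord0) :
  nonexpansive_on (@thompson R N) (@positive_cone R N) (layer W b).
Proof.
case: N W b W_gt0 b_gtN2 => [|N] W b W_gt0 b_gt x y x_gt0 y_gt0.
  (* In dimension 0 both sides are the logarithm of empty folds. *)
  by rewrite /thompson /max_ratio !big_ord0.
have l_ge1 := max_max_ratio_ge1 _ _ _ _ ord0 x_gt0 y_gt0.
have Tl_ge1 := max_max_ratio_ge1 _ _ _ _ ord0 (layer_positive_cone W b x)
  (layer_positive_cone W b y).
rewrite /thompson ler_ln ?posrE ?(lt_le_trans ltr01)//.
(* The same [l], the larger of the two maxima, bounds the ratios in both directions. *)
by rewrite ge_max !max_ratio_layer_le// le_max lexx ?orbT.
Qed.
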